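(* Let $n,m\ge 1$, $\mathcal X\subseteq\mathbb Z^p\times\mathbb R^{n-p}$ with $0\le p\le n$, and for every $i\in[m]$ let $\mathcal U_i\subseteq\mathbb R^{L_i}$, $\overline u^i\in\mathcal U_i$ and $f_i:\mathbb R^n\times\mathcal U_i\to\mathbb R$. Assume that for every $i\in[m]$: (i) there are a matrix $A^i\in\mathbb R^{L_i\times m_i}$ and a convex set $\mathcal Z_i\subseteq\mathbb R^{m_i}$ such that $\mathcal U_i=\{\overline u^i+A^i\zeta^i : \zeta^i\in\mathcal Z_i\}$; (ii) $f_i(x,\cdot):\mathcal U_i\to\mathbb R$ is concave for every $x\in\mathcal X$; (iii) $\overline u^i$ lies in the relative interior of $\mathcal U_i$. Let $\Gamma\in[m]$. Then the $\Gamma$-counterpart $$\inf_{x\in\mathcal X}\ \sup_{\mathcal S\subseteq[m]:|\mathcal S|\le\Gamma}\Big\{\sum_{i\in\mathcal S}\sup_{u^i\in\mathcal U_i}f_i(x,u^i)+\sum_{i\in[m]\setminus\mathcal S}f_i(x,\overline u^i)\Big\}$$ is equivalent to $$\begin{aligned}\inf_{x,p,\theta,v^1,\dots,v^m}\ &\Gamma\theta+\sum_{i\in[m]}\big(f_i(x,\overline u^i)+p_i\big)\\ \text{s.t. }& x\in\mathcal X,\\ & p_i+\theta\ \ge\ (\overline u^i)^Tv^i+\delta^*\big((A^i)^Tv^i\mid\mathcal Z_i\big)-f_{i,*}(x,v^i)-f_i(x,\overline u^i)\quad\forall i\in[m],\\ & p\in\mathbb R^m_{\ge0},\ \theta\in\mathbb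 R_{\ge0},\ v^i\in\mathbb R^{L_i}\ \forall i\in[m].\end{aligned}$$
   Context: Notation: $[m]:=\{1,\dots,m\}$. For a non-empty set $\mathcal S\subseteq\mathbb R^d$ the support function is $\delta^*(z\mid\mathcal S):=\sup_{y\in\mathcal S}y^Tz\in\mathbb R\cup\{\infty\}$. The (partial) concave conjugate of $f_i$ with respect to its second argument is $f_{i,*}(x,v):=\inf_{u\in\mathcal U_i}\{v^Tu-f_i(x,u)\}\in\mathbb R\cup\{-\infty\}$. A constraint whose right-hand side equals $+\infty$ is violated. Two minimization programs in $x$ (possibly with further auxiliary variables or indices) are called equivalent if they have the same optimal value in $[-\infty,\infty]$ and, whenever this value is finite, a point $x\in\mathcal X$ attains it in one program (for a suitable choice of the auxiliary variables or indices) if and only if it does so in the other. *)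

(* Defs.v *)
From HB Require Import structures.
From mathcomp Require Import all_boot all_order all_algebra.
From mathcomp Require Import all_classical all_reals all_analysis.

Set Implicit Arguments.
Unset Strict Implicit.
Unset Printing Implicit Defensive.

Import Order.TTheory GRing.Theory Num.Theory.
Import numFieldNormedType.Exports.

Local Open Scope classical_set_scope.
Local Open Scope ring_scope.

Definition dotv (R : realType) (n : nat) (y z : 'cV[R]_n) : R :=
  (y^T *m z) 0 0.

Definition support_function (R : realType) (n : nat) (S : set 'cV[R]_n)
    (z : 'cV[R]_n) : \bar R :=
  ereal_sup [set (dotv y z)%:E | y in S].

(* [g] is only meant on [U]; its values outside [U] are not used. *)
Definition concave_conjugate (R : realType) (n : nat) (U : set 'cV[R]_n)
    (g : 'cV[R]_n -> R) (v : 'cV[R]_n) : \bar R :=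
  ereal_inf [set (dotv v u - g u)%:E | u in U].

Definition concave_function (R : realType) (n : nat) (U : set 'cV[R]_n)
    (g : 'cV[R]_n -> R) : Prop :=
  @convex_function R 'cV[R]_n U (fun u => - g u).

Definition affine_hull (R : realType) (n : nat) (S : set 'cV[R]_n) :
    set 'cV[R]_n :=
  [set y | exists k (w : 'I_k -> R) (s : 'I_k -> 'cV[R]_n),
     [/\ forall j, S (s j), \sum_(j < k) w j = 1 &
         y = \sum_(j < k) w j *: s j]].

(* Interior of [S] in the topology induced on its affine hull. *)
Definition relative_interior (R : realType) (n : nat) (S : set 'cV[R]_n) :
    set 'cV[R]_n :=
  [set y | affine_hull S y /\ \forall z \near y, affine_hull S z -> S z].

(* Z^p x R^(n-p) *)
Definition mixed_integer (R : realType) (n p : nat) : set 'cV[R]_n :=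
  [set x | forall j : 'I_n, (j < p)%N -> x j 0 \is a Num.int].

(* A minimization program in [x : T], with auxiliary variables in [aux]. *)
Record program (R : realType) (T : Type) := Program {
  aux : Type;
  feasible : T -> aux -> Prop;
  objective : T -> aux -> \bar R }.

Definition optimal_value (R : realType) (T : Type) (P : program R T) : \bar R :=
  ereal_inf
    [set objective xw.1 xw.2 | xw in [set xw : T * aux P | feasible xw.1 xw.2]].

Definition attains (R : realType) (T : Type) (P : program R T) (x : T) : Prop :=
  exists2 w : aux P, feasible x w & objective x w = optimal_value P.

Definition equivalent (R : realType) (T : Type) (P Q : program R T) : Prop :=
  optimal_value P = optimal_value Q /\
  (optimal_value P \is a fin_num -> forall x, attains P x <-> attains Q x).

Definition counterpart_value (R : realType) (n m : nat) (L : 'I_m -> nat)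
    (U : forall i, set 'cV[R]_(L i)) (ubar : forall i, 'cV[R]_(L i))
    (f : forall i, 'cV[R]_n -> 'cV[R]_(L i) -> R) (Gamma : nat)
    (x : 'cV[R]_n) : \bar R :=
  ereal_sup
    [set (\sum_(i in S) ereal_sup [set (f i x u)%:E | u in U i]
          + \sum_(i in ~: S) (f i x (ubar i))%:E)%E
    | S in [set S : {set 'I_m} | (#|S| <= Gamma)%N]].

Definition gamma_counterpart (R : realType) (n m : nat) (X : set 'cV[R]_n)
    (L : 'I_m -> nat) (U : forall i, set 'cV[R]_(L i))
    (ubar : forall i, 'cV[R]_(L i))
    (f : forall i, 'cV[R]_n -> 'cV[R]_(L i) -> R) (Gamma : nat) :
    program R 'cV[R]_n :=
  @Program R 'cV[R]_n unit
    (fun x _ => X x) (fun x _ => counterpart_value U ubar f Gamma x).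

(* Auxiliary variables: q in R^m (called p in the mathematical statement),
   theta in R and v^i in R^(L_i) for each i. When Z_i and U_i are nonempty,
   the support function is never -oo and the conjugate never +oo, so the
   extended-real right-hand side involves no oo - oo; the left-hand side being
   finite, the constraint fails whenever the right-hand side is +oo. *)
Definition gamma_reformulation (R : realType) (n m : nat) (X : set 'cV[R]_n)
    (L k : 'I_m -> nat) (U : forall i, set 'cV[R]_(L i))
    (ubar : forall i, 'cV[R]_(L i))
    (A : forall i, 'M[R]_(L i, k i)) (Z : forall i, set 'cV[R]_(k i))
    (f : forall i, 'cV[R]_n -> 'cV[R]_(L i) -> R) (Gamma : nat) :
    program R 'cV[R]_n :=
  @Program R 'cV[R]_n ('cV[R]_m * R * (forall i, 'cV[R]_(L i)))%type
    (fun x '(q, theta, v) =>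
      [/\ X x,
          forall i : 'I_m,
            ((dotv (ubar i) (v i))%:E
               + support_function (Z i) ((A i)^T *m v i)
               - concave_conjugate (U i) (f i x) (v i)
               - (f i x (ubar i))%:E <= (q i 0 + theta)%:E)%E,
          forall i : 'I_m, 0 <= q i 0
        & 0 <= theta])
    (fun x '(q, theta, v) =>
      (Gamma%:R * theta + \sum_(i < m) (f i x (ubar i) + q i 0))%:E).

(* Main.v *)
Require Import Defs.
From HB Require Import structures.
From mathcomp Require Import all_boot all_order all_algebra.
From mathcomp Require Import all_classical all_reals all_analysis.

Import Order.TTheory GRing.Theory Num.Theory.
Import numFieldNormedType.Exports.

Local Open Scope classical_set_scope.
Local Open Scope ring_scope.

Set Implicit Arguments.
Unset Strict Implicit.


(** The counterpart and the reformulation agree already for each fixed x, and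
    the proof rests on two independent facts.

    The first is that the right-hand side of the i-th constraint, for the best
    choice of v^i, is sup_(u in U_i) f_i(x, u) - f_i(x, ubar^i).  Since U_i is
    ubar^i + A^i Z_i, the terms in ubar^i and Z_i add up to the support
    function of U_i at v^i.  Bounding this support function and the conjugate
    at one and the same point u bounds the right-hand side below by
    f_i(x, u) - f_i(x, ubar^i), whatever v^i is ([sup_le_fenchel_bound]).  The
    choice v^i = 0 attains the bound, since the support function vanishes
    there and the conjugate is minus the supremum of f_i(x, .)
    ([fenchel_bound0]).

    The second is linear programming duality for the sum of the Gamma largest
    entries of a nonnegative vector d, here d_i = sup_u f_i(x, u) -
    f_i(x, ubar^i): the largest sum of d over a set of at most Gamma indices is
    the least value of Gamma theta + sum_i q_i subject to q_i + theta >= d_i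
    and q, theta >= 0.  Weak duality is a summation ([sum_le_dual_value]);
    an optimal theta is a threshold separating the Gamma largest entries from
    the others ([top_threshold], [dual_value_attained]).

    If some supremum is infinite then so is the value of the counterpart,
    because Gamma >= 1 allows the set that consists of this index alone; the
    point x is infeasible for the reformulation.  The passage from fixed x to
    equivalence of the programs is [equivalent_of_dominates]. *)

(** * Comparison of programs *)

(** Points with value +oo are exempt: such a point neither affects the optimal
    value nor attains it when it is finite, and its counterpart in the other
    program may well be infeasible. *)
Definition dominates (R : realType) (T : Type) (P Q : program R T) : Prop :=
  forall x (w : aux Q), feasible x w -> (objective x w < +oo)%E ->
  exists2 w' : aux P, feasible x w' & (objective x w' <= objective x w)%E.

Lemma optimal_value_le (R : realType) (T : Type) (P : program R T) x
    (w : aux P) :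
  feasible x w -> (optimal_value P <= objective x w)%E.
Proof. by move=> xw; apply: ereal_inf_lbound; exists (x, w). Qed.

Lemma dominates_optimal_value (R : realType) (T : Type) (P Q : program R T) :
  dominates P Q -> (optimal_value P <= optimal_value Q)%E.
Proof.
move=> PQ; apply: le_ereal_inf_tmp => _ [[x w]] /= xw <-.
have [->|] := eqVneq (objective x w) +oo%E; first exact: leey.
rewrite -ltey => /(PQ _ _ xw)[w' xw' ww'].
exact: le_trans (optimal_value_le xw') ww'.
Qed.

Lemma dominates_attains (R : realType) (T : Type) (P Q : program R T) x :
  dominates P Q -> optimal_value P = optimal_value Q ->
  optimal_value Q \is a fin_num -> attains Q x -> attains P x.
Proof.
move=> PQ eqPQ finQ [w xw optw].
have [|w' xw' ww'] := PQ x w xw; first by rewrite optw ltey_eq finQ.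
exists w' => //; apply/le_anti; rewrite optimal_value_le // andbT.
by rewrite eqPQ -optw.
Qed.

Lemma equivalent_of_dominates (R : realType) (T : Type) (P Q : program R T) :
  dominates P Q -> dominates Q P -> equivalent P Q.
Proof.
move=> PQ QP.
have eqPQ : optimal_value P = optimal_value Q.
  by apply/le_anti; rewrite !dominates_optimal_value.
split=> // finP x; split; first exact: dominates_attains.
by apply: dominates_attains; rewrite // -eqPQ.
Qed.

(** * The inner supremum as the best Fenchel bound *)

(** Fenchel's dual objective for maximizing g over U: when U = ubar + A Z, the
    first two terms add up to the support function of U at v. *)
Definition fenchel_bound (R : realType) (L k : nat) (U : set 'cV[R]_L)
    (ubar : 'cV[R]_L) (A : 'M[R]_(L, k)) (Z : set 'cV[R]_k)
    (g : 'cV[R]_L -> R) (v : 'cV[R]_L) : \bar R :=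
  ((dotv ubar v)%:E + support_function Z (A^T *m v)
     - concave_conjugate U g v)%E.

Lemma dotvC (R : realType) (n : nat) (y z : 'cV[R]_n) : dotv y z = dotv z y.
Proof.
by rewrite /dotv !mxE; apply: eq_bigr => j _; rewrite !mxE mulrC.
Qed.

Lemma dotv_affine (R : realType) (L k : nat) (ubar : 'cV[R]_L)
    (A : 'M[R]_(L, k)) (zeta : 'cV[R]_k) (v : 'cV[R]_L) :
  dotv v (ubar + A *m zeta) = dotv ubar v + dotv zeta (A^T *m v).
Proof.
by rewrite dotvC /dotv linearD /= mulmxDl mxE trmx_mul mulmxA.
Qed.

Lemma sup_le_fenchel_bound (R : realType) (L k : nat) (ubar : 'cV[R]_L)
    (A : 'M[R]_(L, k)) (Z : set 'cV[R]_k) (g : 'cV[R]_L -> R)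
    (v : 'cV[R]_L) (U := [set ubar + A *m zeta | zeta in Z]) :
  (ereal_sup [set (g u)%:E | u in U] <= fenchel_bound U ubar A Z g v)%E.
Proof.
apply: ge_ereal_sup => _ [u [zeta Zz zu] <-].
have -> : (g u)%:E = ((dotv ubar v)%:E + (dotv zeta (A^T *m v))%:E
                      - (dotv v u - g u)%:E)%E.
  by rewrite -!EFinD -dotv_affine zu opprB addrC subrK.
apply: leeB; first by rewrite leeD2l //; apply: ereal_sup_ubound; exists zeta.
by apply: ereal_inf_lbound; exists u => //; exists zeta.
Qed.

Lemma fenchel_bound0 (R : realType) (L k : nat) (U : set 'cV[R]_L)
    (ubar : 'cV[R]_L) (A : 'M[R]_(L, k)) (Z : set 'cV[R]_k)
    (g : 'cV[R]_L -> R) :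
  Z !=set0 ->
  fenchel_bound U ubar A Z g 0 = ereal_sup [set (g u)%:E | u in U].
Proof.
move=> Z0; have dotr0 j (y : 'cV[R]_j) : dotv y 0 = 0.
  by rewrite /dotv mulmx0 mxE.
have -> : fenchel_bound U ubar A Z g 0 = (- concave_conjugate U g 0)%E.
  rewrite /fenchel_bound /support_function mulmx0 dotr0 add0e.
  under eq_imagel do rewrite dotr0.
  by rewrite set_cst ifN ?ereal_sup1 ?add0e //; apply/set0P.
rewrite /concave_conjugate -ereal_supN image_comp; congr ereal_sup.
by apply: eq_imagel => u _ /=; rewrite /dotv trmx0 mul0mx mxE sub0r opprK.
Qed.

(** * Duality for the sum of the largest entries *)

Lemma sum_le_dual_value (R : realType) (m : nat) (d q : 'I_m -> R) (theta : R)
    (Gamma : nat) (S : {set 'I_m}) :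
  (forall i, d i <= q i + theta) -> (forall i, 0 <= q i) -> 0 <= theta ->
  (#|S| <= Gamma)%N ->
  \sum_(i in S) d i <= Gamma%:R * theta + \sum_(i < m) q i.
Proof.
move=> dq q0 theta0 SG.
apply: (le_trans (ler_sum _ (fun i _ => dq i))).
rewrite big_split /= addrC sumr_const mulr_natl lerD //.
  by rewrite ler_wpMn2l.
by rewrite [leRHS](bigID (mem S)) /= lerDl sumr_ge0.
Qed.

(** A set with the largest sum among those with Gamma elements has this
    property: exchanging an element for one outside with a larger entry would
    increase the sum. *)
Lemma top_threshold (R : realType) (m Gamma : nat) (d : 'I_m -> R) :
  (0 < Gamma <= m)%N ->
  exists S : {set 'I_m}, #|S| = Gamma /\
    exists2 s, s \in S & (forall i, i \in S -> d s <= d i) /\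
                         (forall j, j \notin S -> d j <= d s).
Proof.
case/andP=> G0 Gm.
have [S0 S0G] : exists S0 : {set 'I_m}, #|S0| == Gamma.
  have [S0] : exists S0 : {set 'I_m},
      S0 \in [set B : {set 'I_m} | #|B| == Gamma]%SET.
    by apply/card_gt0P; rewrite card_draws card_ord bin_gt0.
  by rewrite inE; exists S0.
have [S /eqP SG maxS] :=
  @arg_maxP _ _ _ S0 (fun B : {set 'I_m} => #|B| == Gamma)
            (fun B => \sum_(i in B) d i) S0G.
have /card_gt0P[s0 s0S] : (0 < #|S|)%N by rewrite SG.
have [s sS mins] := @arg_minP _ _ _ s0 (mem S) d s0S.
have {}sS : s \in S by [].
exists S; split=> //; exists s => //; split=> // j jS.
have jSs : j \notin S :\ s by rewrite in_setD1 negb_and jS orbT.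
have /maxS : #|j |: S :\ s| == Gamma.
  by rewrite cardsU1 jSs -SG (cardsD1 s S) sS.
by rewrite big_setU1 //= (big_setD1 s sS) lerD2r.
Qed.

(** With theta the threshold of a top set S of Gamma entries, the positive part
    of d - theta vanishes off S and equals d - theta on S, so the Gamma copies
    of theta are exactly what is missing from the sum over S. *)
Lemma dual_value_attained (R : realType) (m Gamma : nat) (d : 'I_m -> R) :
  (0 < Gamma <= m)%N -> (forall i, 0 <= d i) ->
  exists (S : {set 'I_m}) (theta : R), [/\ (#|S| <= Gamma)%N, 0 <= theta &
    Gamma%:R * theta + \sum_(i < m) Num.max (d i - theta) 0
      = \sum_(i in S) d i].
Proof.
move=> hG d0; have [S [SG [s sS [ges les]]]] := top_threshold d hG.
exists S, (d s); split; rewrite ?SG //.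
rewrite (bigID (mem S)) /= [X in _ + (_ + X)]big1 ?addr0; last first.
  by move=> j jS; apply/max_r; rewrite subr_le0 les.
rewrite mulr_natl -SG -sumr_const -big_split /=; apply: eq_bigr => i iS.
by rewrite max_l ?subr_ge0 ?ges // addrC subrK.
Qed.

(** * The counterpart at a fixed point *)

Lemma sum_shift (V : zmodType) (I : finType) (S : {set I}) (a d : I -> V) :
  \sum_(i in S) (a i + d i) + \sum_(i in ~: S) a i
    = \sum_i a i + \sum_(i in S) d i.
Proof.
rewrite big_split /= addrAC; congr (_ + _).
rewrite [RHS](bigID (mem S)) /=; congr (_ + _).
by apply: eq_bigl => i; rewrite inE.
Qed.

(** The singleton of i is an admissible set as soon as Gamma >= 1, and the
    remaining terms are finite, so an infinite supremum at i would make the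
    counterpart infinite. *)
Lemma sup_lt_pinfty (R : realType) (n m : nat) (L : 'I_m -> nat)
    (U : forall i, set 'cV[R]_(L i)) (ubar : forall i, 'cV[R]_(L i))
    (f : forall i, 'cV[R]_n -> 'cV[R]_(L i) -> R) (Gamma : nat) x i :
  (0 < Gamma)%N -> (counterpart_value U ubar f Gamma x < +oo)%E ->
  (ereal_sup [set (f i x u)%:E | u in U i] < +oo)%E.
Proof.
move=> G0; apply: contraTT; rewrite -!leNgt !leye_eq => /eqP supi.
rewrite -leye_eq; apply: ereal_sup_ubound; exists [set i]%SET.
  by rewrite /= cards1.
by rewrite big_set1 supi sumEFin.
Qed.

Unset Implicit Arguments.
Set Strict Implicit.

Theorem corollary3p6 (R : realType) (n m p : nat)
  (hn : (1 <= n)%N) (hm : (1 <= m)%N) (hp : (p <= n)%N)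
  (X : set 'cV[R]_n) (hX : X `<=` @mixed_integer R n p)
  (L k : 'I_m -> nat)
  (U : forall i : 'I_m, set 'cV[R]_(L i))
  (ubar : forall i : 'I_m, 'cV[R]_(L i))
  (hubar : forall i : 'I_m, U i (ubar i))
  (f : forall i : 'I_m, 'cV[R]_n -> 'cV[R]_(L i) -> R)
  (A : forall i : 'I_m, 'M[R]_(L i, k i))
  (Z : forall i : 'I_m, set 'cV[R]_(k i))
  (hZ : forall i : 'I_m, convex_set (Z i))
  (hU : forall i : 'I_m, U i = [set ubar i + A i *m zeta | zeta in Z i])
  (hf : forall (i : 'I_m) (x : 'cV[R]_n), X x -> concave_function (U i) (f i x))
  (hri : forall i : 'I_m, relative_interior (U i) (ubar i))
  (Gamma : nat) (hGamma : (1 <= Gamma <= m)%N) :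
  equivalent (gamma_counterpart X U ubar f Gamma)
             (gamma_reformulation X U ubar A Z f Gamma).
Proof.
have [G0 _] := andP hGamma.
have Z0 i : Z i !=set0.
  by have := hubar i; rewrite hU => -[zeta Zz _]; exists zeta.
pose F i x := ereal_sup [set (f i x u)%:E | u in U i].
have fF i x : ((f i x (ubar i))%:E <= F i x)%E.
  by apply: ereal_sup_ubound; exists (ubar i).
apply: equivalent_of_dominates => x.
- move=> [[q theta] v] /= [Xx hq q0 theta0] _; exists tt => //.
  have Fq i : (F i x <= (f i x (ubar i) + (q i 0 + theta))%:E)%E.
    rewrite addrC EFinD -leeBlDr //; apply: le_trans (hq i).
    rewrite leeD2r // /F [U i in X in (X <= _)%E]hU.
    by apply: le_trans (sup_le_fenchel_bound _ _ _ _ (v i)) _; rewrite -hU.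
  apply: ge_ereal_sup => _ [S /= SG <-].
  apply: (@le_trans _ _ (\sum_(i in S) (f i x (ubar i) + (q i 0 + theta))%:E
                         + \sum_(i in ~: S) (f i x (ubar i))%:E)%E).
    by apply: leeD2r; apply: lee_sum => i _; apply: Fq.
  rewrite !sumEFin -EFinD lee_fin sum_shift [in leRHS]big_split /= addrCA lerD2l.
  exact: sum_le_dual_value.
- move=> [] /= Xx cfin.
  have Ffin i : F i x \is a fin_num.
    rewrite fin_numElt (sup_lt_pinfty i G0 cfin) andbT.
    exact: lt_le_trans (ltNyr _) (fF i x).
  pose d i := fine (F i x) - f i x (ubar i).
  have d0 i : 0 <= d i by rewrite subr_ge0 -lee_fin fineK.
  have [S [theta [SG theta0 dual]]] := dual_value_attained hGamma d0.
  (* The zero vectors v^i turn each Fenchel bound into the supremum itself. *)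
  exists (\col_i Num.max (d i - theta) 0, theta, fun=> 0).
    split=> // i; last by rewrite mxE le_max lexx orbT.
    rewrite -/(fenchel_bound _ _ _ _ _ _) fenchel_bound0 // -/(F i x).
    by rewrite -(fineK (Ffin i)) -EFinB lee_fin mxE -lerBlDr le_max lexx.
  apply: le_ereal_sup_tmp; eexists; first by exists S.
  under [X in (_ <= X + _)%E]eq_bigr => i _ do rewrite -/(F i x) -(fineK (Ffin i)).
  rewrite !sumEFin -EFinD lee_fin big_split /= addrCA.
  under [X in _ + (_ + X) <= _]eq_bigr do rewrite mxE.
  rewrite dual -sum_shift lerD2r ler_sum // => i _.
  by rewrite addrC subrK.
Qed.
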